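(* Let $\alpha>1$ and let $\phi(n)=e^{\alpha^n}$ for $n\in\mathbb N$. Then $\dim_{\mathcal H}E(\phi)=\frac{1}{1+\alpha}$.
   Context: Every irrational $x\in(0,1)$ has a unique simple continued fraction expansion $x=[a_1(x),a_2(x),a_3(x),\ldots]=\cfrac{1}{a_1(x)+\cfrac{1}{a_2(x)+\cdots}}$ with positive integers $a_n(x)$ (partial quotients). For irrational $x\in(0,1)$ and $n\ge1$, $S_n(x)=\sum_{i=1}^n a_i(x)a_{i+1}(x)$. For a function $\phi:\mathbb N\to\mathbb R_+$, $E(\phi)$ is the set of (irrational) $x\in(0,1)$ such that $\lim_{n\to\infty}S_n(x)/\phi(n)=1$. $\dim_{\mathcal H}$ denotes Hausdorff dimension. *)

(* Defs.v *)
From HB Require Import structures.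
From mathcomp Require Import all_boot all_order all_algebra.
From mathcomp Require Import all_classical all_reals all_analysis.
From mathcomp Require Import ring lra.
Set Implicit Arguments.
Unset Strict Implicit.
Unset Printing Implicit Defensive.
Import Order.TTheory GRing.Theory Num.Theory.
Import numFieldNormedType.Exports.
Local Open Scope classical_set_scope.
Local Open Scope ring_scope.

(* Partial quotients are indexed from 0 here: [a n] is the a_(n+1) of the usual
   notation, so that [cf_convergent a n] is the finite continued fraction
   [a_1, ..., a_n] = 1 / (a_1 + 1 / (... + 1 / a_n)). *)
Fixpoint cf_convergent (R : realType) (a : nat -> nat) (n : nat) : R :=
  if n is m.+1
  then ((a 0%N)%:R + cf_convergent R (fun i => a i.+1) m)^-1
  else 0.

Definition cf_expansion (R : realType) (x : R) (a : nat -> nat) : Prop :=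
  (forall n, (0 < a n)%N) /\ (cf_convergent R a n @[n --> \oo] --> x).

(* Meaningful for irrational x in (0,1), where the expansion exists and is
   unique: see [partial_quotientsP]. *)
Definition partial_quotients (R : realType) (x : R) : nat -> nat :=
  get (cf_expansion x).

(* S_n(x) = a_1 a_2 + a_2 a_3 + ... + a_n a_(n+1). *)
Definition cf_sum_prod (R : realType) (x : R) (n : nat) : nat :=
  (\sum_(i < n) partial_quotients x i * partial_quotients x i.+1)%N.

Definition cf_level_set (R : realType) (phi : nat -> R) : set R :=
  [set x | [/\ irrational x, 0 < x < 1
             & (cf_sum_prod x n)%:R / phi n @[n --> \oo] --> (1 : R)]].

Section hausdorff_dimension.
Local Open Scope ereal_scope.

Definition diameter (R : realType) (U : set R) : \bar R :=
  ereal_sup [set `|x - y|%:E | x in U & y in U].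

(* The empty set has weight 0 for every s, a nonempty set has weight 1 for
   s = 0, so that the 0-dimensional measure counts points. *)
Definition hausdorff_weight (R : realType) (s : R) (U : set R) : \bar R :=
  if U == set0 then 0 else diameter U `^ s.

Definition small_cover (R : realType) (delta : R) (A : set R) : set (nat -> set R) :=
  [set U | (forall k, diameter (U k) <= delta%:E) /\ A `<=` \bigcup_k U k].

Definition hausdorff_premeasure (R : realType) (s delta : R) (A : set R) : \bar R :=
  ereal_inf [set \sum_(k <oo) hausdorff_weight s (U k) | U in small_cover delta A].

Definition hausdorff_measure (R : realType) (s : R) (A : set R) : \bar R :=
  ereal_sup [set hausdorff_premeasure s delta A | delta in [set d : R | (0 < d)%R]].

Definition hausdorff_dim (R : realType) (A : set R) : \bar R :=
  ereal_inf [set s%:E | s in [set s : R | (0 <= s)%R /\ hausdorff_measure s A = 0]].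

End hausdorff_dimension.

Section continued_fraction_expansion.
Variable R : realType.
Implicit Types (x : R) (a : nat -> nat).

Let unit_irr x := irrational x /\ 0 < x < 1.

Definition gauss_map x : R := x^-1 - (Num.truncn x^-1)%:R.

Definition gauss_digits x (n : nat) : nat :=
  Num.truncn (iter n gauss_map x)^-1.

Lemma irrational_inv_subn x (n : nat) : irrational x -> irrational (x^-1 - n%:R).
Proof.
move=> ix [q _ qE]; apply: ix; exists (q + n%:R)^-1 => //.
by rewrite fmorphV rmorphD /= ratr_nat qE subrK invrK.
Qed.

Lemma irrational_neq_nat x (n : nat) : irrational x -> x != n%:R.
Proof.
by move=> ix; apply/eqP => xn; apply: ix; exists n%:R => //; rewrite ratr_nat.
Qed.

Lemma gauss_map_unit_irr x : unit_irr x -> unit_irr (gauss_map x).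
Proof.
move=> [ix /andP[x0 x1]].
have ig : irrational (gauss_map x) by exact: irrational_inv_subn.
have xV0 : 0 < x^-1 by rewrite invr_gt0.
split=> //; have /andP[h1 h2] := truncn_itv (ltW xV0).
have : gauss_map x != 0 by exact: (irrational_neq_nat 0 ig).
move: h1 h2; rewrite /gauss_map -natr1 => h1 h2 gx.
rewrite lt_neqAle eq_sym gx /= subr_ge0; apply/andP; split; first by [].
lra.
Qed.

Lemma gauss_digits_gt0 x n : unit_irr x -> (0 < gauss_digits x n)%N.
Proof.
move=> ux; have : unit_irr (iter n gauss_map x).
  by elim: n => //= n; exact: gauss_map_unit_irr.
move=> [_ /andP[y0 y1]]; rewrite /gauss_digits truncn_gt_nat.
by rewrite -invr1 lef_pV2 ?posrE// ltW.
Qed.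

Lemma cf_convergent_itv a n : (forall n, (0 < a n)%N) ->
  0 <= cf_convergent R a n <= 1.
Proof.
elim: n a => [a _|n ih a a0] /=; first by rewrite lexx ler01.
have /andP[c0 c1] := ih (fun i => a i.+1) (fun i => a0 i.+1).
have a1 : 1 <= (a 0%N)%:R :> R by rewrite ler1n.
have d1 : 1 <= (a 0%N)%:R + cf_convergent R (fun i => a i.+1) n by lra.
by rewrite invr_ge0 (le_trans ler01 d1) invf_le1// (lt_le_trans ltr01 d1).
Qed.

Lemma inv_contraction (a u v e : R) : 1 <= a -> 0 <= u -> 0 <= v -> 0 < e ->
  `|u - v| <= e^-1 -> `|(a + u)^-1 - (a + v)^-1| <= (e + 1)^-1.
Proof.
move=> a1 u0 v0 e0 uve.
have au : 0 < a + u by lra.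
have av : 0 < a + v by lra.
have -> : (a + u)^-1 - (a + v)^-1 = (v - u) / ((a + u) * (a + v)).
  by field; rewrite !gt_eqF.
rewrite normrM normfV (gtr0_norm (mulr_gt0 au av)) distrC.
rewrite ler_pdivrMr ?mulr_gt0// mulrC ler_pdivlMr; last by lra.
have : `|u - v| * e <= 1 by rewrite -ler_pdivlMr// mul1r.
have : `|u - v| <= (a + u) * (a + v) - 1 by rewrite ler_norml; nra.
by nra.
Qed.

Lemma cf_convergent_gauss_digits x n : unit_irr x ->
  `|cf_convergent R (gauss_digits x) n - x| <= n.+1%:R^-1.
Proof.
elim: n x => [x [_ /andP[x0 x1]]|n ih x ux].
  by rewrite /= sub0r normrN gtr0_norm// invr1 ltW.
have gx := gauss_map_unit_irr ux.
have -> : cf_convergent R (gauss_digits x) n.+1 =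
    ((gauss_digits x 0)%:R + cf_convergent R (gauss_digits (gauss_map x)) n)^-1.
  rewrite /=; congr (_ + cf_convergent R _ _)^-1.
  by apply/funext => i; rewrite /gauss_digits iterSr.
have {3}-> : x = ((gauss_digits x 0)%:R + gauss_map x)^-1.
  by rewrite /gauss_map /gauss_digits/= addrC subrK invrK.
rewrite -(natr1 n.+1); apply: inv_contraction.
- by rewrite ler1n gauss_digits_gt0.
- by have /andP[] := cf_convergent_itv n (fun i => gauss_digits_gt0 i gx).
- by case: gx => _ /andP[/ltW].
- by rewrite ltr0n.
- exact: ih.
Qed.

Lemma gauss_digits_expansion x : irrational x -> 0 < x < 1 ->
  cf_expansion x (gauss_digits x).
Proof.
move=> ix x01; split; first by move=> n; exact: gauss_digits_gt0.
apply/cvgrPdist_le => /= e e0.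
have : (@harmonic R) n @[n --> \oo] --> (0 : R) by exact: cvg_harmonic.
move=> /cvgrPdist_le/(_ e e0); apply: filterS => n /=.
rewrite sub0r normrN ger0_norm ?invr_ge0// distrC.
by apply: le_trans; exact: cf_convergent_gauss_digits.
Qed.

Lemma cf_expansion_gauss_map x a : unit_irr x -> cf_expansion x a ->
  a 0%N = gauss_digits x 0 /\ cf_expansion (gauss_map x) (fun i => a i.+1).
Proof.
move=> [ix /andP[x0 x1]] [a0 ax].
have cx : cf_convergent R (fun i => a i.+1) n @[n --> \oo] --> x^-1 - (a 0%N)%:R.
  have : (cf_convergent R a n.+1)^-1 - (a 0%N)%:R @[n --> \oo] --> x^-1 - (a 0%N)%:R.
    apply: cvgB; last exact: cvg_cst.
    apply: cvgV; first by rewrite gt_eqF.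
    by rewrite (cvg_shiftS (cf_convergent R a)).
  by apply: cvg_trans; apply: near_eq_cvg; near=> n; rewrite /= invrK addrC addKr.
have cI n := cf_convergent_itv n (fun i => a0 i.+1).
have y0 : 0 <= x^-1 - (a 0%N)%:R.
  rewrite -(cvg_lim _ cx)//; apply: limr_ge; first by apply/cvg_ex; eexists; exact: cx.
  by near=> n; have /andP[] := cI n.
have y1 : x^-1 - (a 0%N)%:R <= 1.
  rewrite -(cvg_lim _ cx)//; apply: limr_le; first by apply/cvg_ex; eexists; exact: cx.
  by near=> n; have /andP[] := cI n.
have iy : irrational (x^-1 - (a 0%N)%:R) by exact: irrational_inv_subn.
have a0E : Num.truncn x^-1 = a 0%N.
  apply: truncn_def; rewrite -natr1 -subr_ge0 y0 /= -ltrBlDl lt_neqAle y1 andbT.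
  exact: (irrational_neq_nat 1 iy).
split; first by rewrite /gauss_digits /= a0E.
by split=> [n|]; [exact: a0|rewrite /gauss_map a0E].
Unshelve. all: by end_near. Qed.

Lemma cf_expansion_unique x a : irrational x -> 0 < x < 1 ->
  cf_expansion x a -> a = gauss_digits x.
Proof.
move=> ix x01 ax; apply/funext => n; have ux : unit_irr x by [].
elim: n x a ux ax {ix x01} => [|n ih] x a ux ax.
  by have [] := cf_expansion_gauss_map ux ax.
have [_ /(ih _ _ (gauss_map_unit_irr ux)) ->] := cf_expansion_gauss_map ux ax.
by rewrite /gauss_digits -iterSr.
Qed.

Lemma partial_quotientsE x : irrational x -> 0 < x < 1 ->
  partial_quotients x = gauss_digits x.
Proof.
move=> ix x01; apply: cf_expansion_unique => //.
by apply: getPex; exists (gauss_digits x); exact: gauss_digits_expansion.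
Qed.

Lemma partial_quotientsP x a : irrational x -> 0 < x < 1 ->
  cf_expansion x a <-> a = partial_quotients x.
Proof.
move=> ix x01; rewrite partial_quotientsE//; split=> [|->].
  exact: cf_expansion_unique.
exact: gauss_digits_expansion.
Qed.

End continued_fraction_expansion.

(* Main.v *)
Require Import Defs.
From mathcomp Require Import all_boot all_order all_algebra.
From mathcomp Require Import all_classical all_reals all_analysis.
From mathcomp Require Import ring lra.
Import Order.TTheory GRing.Theory Num.Theory.
Import numFieldNormedType.Exports.
Local Open Scope classical_set_scope.
Local Open Scope ring_scope.
Set Implicit Arguments.
Unset Strict Implicit.
Unset Printing Implicit Defensive.

(* Since phi(n) = o(phi(n+1)), the condition S_n ~ phi(n) amounts to
   a_n a_(n+1) ~ phi(n).

   Upper bound: if phi(i)/2 <= a_i a_(i+1) <= 2 phi(i) from some index on, then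
   the cylinder of a word w of length n, on which a_(n+1) >= phi(n)/(2 a_n), has
   length at most 2 a_n / (a_1^2 ... a_n^2 phi(n)). Two more digits multiply the
   number of words by at most 8 phi(n+1), and the lengths by at most
   4 / (phi(n+1) phi(n+2)), where phi(n+1) phi(n+2) = phi(n+1)^(1 + alpha). Hence
   the sums of the s-th powers of the lengths tend to 0 when s (1 + alpha) > 1.

   Lower bound: put A_n = exp(alpha^n / (1 + alpha)), so that
   A_n A_(n+1) = phi(n), and let a_n range over about A_n/n consecutive integers
   above A_n. Mapping the mixed radix digits of t in [0, 1[ to these digits a_n
   gives a map f from [0, 1[ to the level set with
   |t - u| <= C |f(t) - f(u)|^s when s (1 + alpha) < 1, and Lebesgue measure on
   [0, 1[ bounds the s-dimensional Hausdorff measure from below. *)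

(** * Hausdorff content *)

Section hausdorff_content.
Local Open Scope ereal_scope.
Context {R : realType}.
Implicit Types (s : R) (U A : set R).

(** Every set is measurable here, so that [mu_ext] takes its infimum over covers by arbitrary
    sets. *)
Let discrete := g_sigma_algebraType (@discrete_measurable R).

Lemma measurable_discrete (A : set R) : measurable (A : set discrete).
Proof. exact: sub_sigma_algebra. Qed.

Lemma hausdorff_weight_ge0 s U : 0 <= hausdorff_weight s U.
Proof. by rewrite /hausdorff_weight; case: ifP => // _; exact: poweR_ge0. Qed.

Lemma hausdorff_weight0 s : hausdorff_weight s (@set0 R) = 0.
Proof. by rewrite /hausdorff_weight eqxx. Qed.

(** The diameters of the covers are left unbounded, which makes the content an instance of [mu_ext]
    and provides countable subadditivity. *)
Definition hausdorff_content s (A : set R) : \bar R :=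
  mu_ext (hausdorff_weight s : set discrete -> \bar R) (A : set discrete).

Lemma hausdorff_content_ge0 s A : 0 <= hausdorff_content s A.
Proof. by apply: mu_ext_ge0 => U; exact: hausdorff_weight_ge0. Qed.

Lemma hausdorff_content0 s : hausdorff_content s set0 = 0.
Proof.
by apply: mu_ext0 => [|U]; [exact: hausdorff_weight0|exact: hausdorff_weight_ge0].
Qed.

Lemma le_hausdorff_content s A B :
  A `<=` B -> hausdorff_content s A <= hausdorff_content s B.
Proof. by move=> AB; exact: le_mu_ext. Qed.

Lemma hausdorff_content_sigma_subadditive s (F : nat -> set R) :
  hausdorff_content s (\bigcup_n F n) <= \sum_(n <oo) hausdorff_content s (F n).
Proof. by apply: mu_ext_sigma_subadditive => U; exact: hausdorff_weight_ge0. Qed.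

Lemma hausdorff_content_countable (T : countType) s (F : T -> set R) :
  (forall i, hausdorff_content s (F i) = 0) ->
  hausdorff_content s (\bigcup_i F i) = 0.
Proof.
move=> F0; apply/eqP; rewrite eq_le hausdorff_content_ge0 andbT.
pose G n := if unpickle n is Some i then F i else set0.
have G0 n : hausdorff_content s (G n) = 0.
  by rewrite /G; case: unpickle => [i|//]; rewrite ?F0 ?hausdorff_content0.
apply: (@le_trans _ _ (hausdorff_content s (\bigcup_n G n))).
  apply: le_hausdorff_content => x [i _ Fix]; exists (pickle i) => //.
  by rewrite /G pickleK.
apply: (le_trans (hausdorff_content_sigma_subadditive s G)).
by rewrite eseries0// => n _ _; exact: G0.
Qed.

(** There are at most [Y] positive integers up to [Y], and subadditivity adds up their
    contributions. In the applications [Y] bounds an admissible digit. *)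
Lemma hausdorff_content_bigcup_le s (Y e : R) (P : pred nat) (F : nat -> set R) A :
  (0 <= Y)%R -> (0 <= e)%R ->
  A `<=` \bigcup_(i in [set i | (0 < i)%N && (i%:R <= Y)%R && P i]) F i ->
  (forall i, P i -> hausdorff_content s (F i) <= e%:E) ->
  hausdorff_content s A <= (Y * e)%:E.
Proof.
move=> Y0 e0 AF Fe.
pose K := Num.truncn Y.
pose G n := if (n < K)%N && P n.+1 then F n.+1 else set0.
have G0 n : ~~ ((n < K)%N && P n.+1) -> hausdorff_content s (G n) = 0.
  by rewrite /G => /negbTE ->; exact: hausdorff_content0.
apply: (@le_trans _ _ (hausdorff_content s (\bigcup_n G n))).
  apply: le_hausdorff_content => x /AF[i /= /andP[/andP[i0 iY] Pi] Fix].
  by exists i.-1 => //; rewrite /G prednK// Pi andbT truncn_ge_nat// iY.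
apply: (le_trans (hausdorff_content_sigma_subadditive s G)).
rewrite (nneseries_split _ K); last by move=> *; exact: hausdorff_content_ge0.
rewrite add0n eseries0 ?adde0; last first.
  by move=> n Kn _; rewrite G0// ltnNge Kn.
apply: (@le_trans _ _ (\sum_(i < K) e%:E)).
  rewrite big_mkord; apply: lee_sum => i _.
  have [iP|/G0 ->] := boolP ((i < K)%N && P i.+1); last by rewrite lee_fin.
  by rewrite /G iP; apply: Fe; case/andP: iP.
rewrite sumEFin lee_fin sumr_const card_ord -mulr_natl ler_wpM2r//.
by have /truncn_itv/andP[] := Y0.
Qed.

Lemma diameter_ge0 U : U !=set0 -> 0 <= diameter U.
Proof.
move=> [x Ux]; apply: ereal_sup_ubound; exists x => //; exists x => //.
by rewrite subrr normr0.
Qed.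

Lemma le_hausdorff_weight s U (d : R) : (0 <= s)%R -> (0 <= d)%R ->
  (forall x y, U x -> U y -> (`|x - y| <= d)%R) ->
  hausdorff_weight s U <= (d `^ s)%:E.
Proof.
move=> s0 d0 Ud; rewrite /hausdorff_weight; case: eqP => [_|/eqP/set0P U0].
  by rewrite lee_fin powR_ge0.
rewrite -poweR_EFin; apply: gt0_ler_poweR => //.
- by rewrite in_itv/= leey diameter_ge0.
- by rewrite in_itv/= leey lee_fin d0.
- by apply: ge_ereal_sup => _ [x Ux [y Uy <-]]; rewrite lee_fin; exact: Ud.
Qed.

Lemma hausdorff_content_le_diam s U (d : R) : (0 <= s)%R -> (0 <= d)%R ->
  (forall x y, U x -> U y -> (`|x - y| <= d)%R) ->
  hausdorff_content s U <= (d `^ s)%:E.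
Proof.
move=> s0 d0 Ud; apply: le_trans (le_hausdorff_weight s0 d0 Ud).
pose G n := if n is 0%N then U else set0.
apply: ereal_inf_lbound; exists G => /=.
  by split=> [k|x Ux]; [exact: measurable_discrete|exists 0%N].
rewrite (nneseries_split _ 1); last by move=> *; exact: hausdorff_weight_ge0.
rewrite add0n eseries0 ?adde0 ?big_nat1//.
by move=> [//|n] _ _; exact: hausdorff_weight0.
Qed.

(* For s > 0, a cover of small total weight consists of sets of small diameter. *)
Lemma hausdorff_measure_eq0 s A : (0 < s)%R ->
  hausdorff_content s A = 0 -> hausdorff_measure s A = 0.
Proof.
move=> s0 A0; apply/eqP; rewrite eq_le; apply/andP; split; last first.
  apply: ereal_sup_ge; exists (hausdorff_premeasure s 1 A).
    by exists 1%R => //=.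
  apply: le_ereal_inf_tmp => _ [U _ <-]; apply: nneseries_ge0 => n _ _.
  exact: hausdorff_weight_ge0.
apply: ge_ereal_sup => _ [d /= d0 <-].
apply/lee_addgt0Pr => e e0; rewrite add0e.
(* A total weight below [d ^ s] forces each diameter to be at most [d], while [e] bounds the sum
   itself. *)
pose m : R := Num.min e (powR d s).
have m0 : (0 < m)%R by rewrite lt_min e0 powR_gt0.
have h0 : hausdorff_content s A \is a fin_num by rewrite A0.
have [_ [U [_ AU] <-]] := lb_ereal_inf_adherent m0 h0.
rewrite -/(mu_ext _ _) -/(hausdorff_content s A) A0 add0e => Um.
apply: (@le_trans _ _ (\sum_(k <oo) hausdorff_weight s (U k))); last first.
  by apply: (le_trans (ltW Um)); rewrite lee_fin /m ge_min lexx.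
apply: ereal_inf_lbound; exists U => //; split=> // k.
have [->|/set0P Uk0] := eqVneq (U k) set0.
  by apply: ge_ereal_sup => _ [x []].
have : hausdorff_weight s (U k) < (d `^ s)%:E.
  apply: (@lt_le_trans _ _ m%:E); last by rewrite lee_fin /m ge_min lexx orbT.
  apply: le_lt_trans Um.
  rewrite (nneseries_split _ k.+1); last by move=> *; exact: hausdorff_weight_ge0.
  rewrite add0n big_nat_recr//= -addeA addeCA leeDl//.
  rewrite adde_ge0//; first by apply: sume_ge0 => *; exact: hausdorff_weight_ge0.
  by apply: nneseries_ge0 => *; exact: hausdorff_weight_ge0.
rewrite /hausdorff_weight ifF; last by apply/negbTE/set0P.
rewrite -poweR_EFin; apply: contraTT; rewrite -leNgt -ltNge => dU.
apply: gt0_ler_poweR; [exact: ltW| | |exact: ltW].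
- by rewrite in_itv/= leey lee_fin ltW.
- by rewrite in_itv/= leey diameter_ge0.
Qed.
End hausdorff_content.

(** * Lower bounds from maps with a Hölder inverse *)

Section holder_lower_bound.
Local Open Scope ereal_scope.
Context {R : realType}.

Lemma le_dist_hausdorff_weight (s : R) (U : set R) x y : (0 <= s)%R -> U x -> U y ->
  ((`|x - y| `^ s)%R)%:E <= hausdorff_weight s U.
Proof.
move=> s0 Ux Uy; have U0 : U !=set0 by exists x.
rewrite /hausdorff_weight ifF; last by apply/negbTE/set0P.
rewrite -poweR_EFin; apply: gt0_ler_poweR => //.
- by rewrite in_itv/= leey lee_fin normr_ge0.
- by rewrite in_itv/= leey diameter_ge0.
- by apply: ereal_sup_ubound; exists x => //; exists y.
Qed.

(* The sets of a cover pull back under f to a cover of [0, 1[, whose pieces have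
   length at most 2 C times the weight of the original ones. *)
Lemma inverse_holder_hausdorff_measure_neq0 (s C : R) (f : R -> R) (A : set R) :
  (0 <= s)%R -> (0 < C)%R ->
  (forall t, (0 <= t < 1)%R -> A (f t)) ->
  (forall t u, (0 <= t < 1)%R -> (0 <= u < 1)%R ->
    (`|t - u| <= C * `|f t - f u| `^ s)%R) ->
  hausdorff_measure s A != 0.
Proof.
move=> s0 C0 fA fH; rewrite gt_eqF//.
have C20 : (0 < C *+ 2)%R by rewrite pmulrn_rgt0.
apply: (@lt_le_trans _ _ ((C *+ 2)^-1)%:E); first by rewrite lte_fin invr_gt0.
apply: ereal_sup_ge; exists (hausdorff_premeasure s 1 A); first by exists 1%R => //=.
apply: le_ereal_inf_tmp => _ [U [_ AU] <-].
have [[k wk]|wfin] := pselect (exists k, hausdorff_weight s (U k) = +oo).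
  rewrite (eseries_pinfty _ _ wk) ?leey// => n _.
  by rewrite -ltNye (lt_le_trans _ (hausdorff_weight_ge0 _ _)).
have wE k : hausdorff_weight s (U k) = (fine (hausdorff_weight s (U k)))%:E.
  rewrite fineK// ge0_fin_numE ?hausdorff_weight_ge0// ltey.
  by apply/eqP => wk; apply: wfin; exists k.
pose w k := (C * fine (hausdorff_weight s (U k)))%R.
have w0 k : (0 <= w k)%R.
  by rewrite mulr_ge0 ?(ltW C0)// fine_ge0// hausdorff_weight_ge0.
pose V k := [set t : R | (0 <= t < 1)%R /\ U k (f t)].
(* If no point of [0, 1[ is sent into [U k], then [c k] is a default value, and the interval around
   it merely enlarges the cover. *)
pose c k := get (V k).
pose I k : set R := `[(c k - w k)%R, (c k + w k)%R]%classic.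
have mu01 : (lebesgue_measure `[0%R, 1%R[%classic : \bar R) = 1.
  by rewrite lebesgue_measure_itv/= lte_fin ltr01 oppr0 adde0.
have sub : `[0%R, 1%R[%classic `<=` \bigcup_k I k.
  move=> t /=; rewrite in_itv/= => t01.
  have [k _ Ukt] := AU _ (fA _ t01); exists k => //.
  have [c01 Uc] : V k (c k) by apply: getPex; exists t.
  rewrite /I/= in_itv/= -ler_distl distrC.
  rewrite (le_trans (fH _ _ c01 t01))// /w ler_pM2l//.
  by rewrite -lee_fin -wE; exact: le_dist_hausdorff_weight.
have le1 : 1 <= \sum_(k <oo) (lebesgue_measure (I k) : \bar R).
  rewrite -mu01; apply: measure_sigma_subadditive => //= k.
  exact: measurable_itv.
have muI k : lebesgue_measure (I k) = (C *+ 2)%:E * hausdorff_weight s (U k).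
  rewrite lebesgue_measure_itv/= lte_fin wE -EFinM.
  have [_|] := ltP; first by rewrite -EFinB /w; congr EFin; ring.
  by move=> h; congr EFin; move: h (w0 k); rewrite /w => h1 h2; lra.
rewrite (eq_eseriesr (fun k _ => muI k)) in le1.
rewrite nneseriesZl in le1; last by move=> *; exact: hausdorff_weight_ge0.
by rewrite -[leLHS]mule1 lee_pdivrMl.
Qed.
End holder_lower_bound.

(** * Values of infinite continued fractions *)

Lemma natr_dist_ge1 {R : realType} (m n : nat) : m != n -> 1 <= `|m%:R - n%:R| :> R.
Proof.
move=> mn; rewrite ler_normr; apply/orP.
by case: ltngtP mn => // + _; rewrite -(ler_nat R) -natr1; [right|left]; lra.
Qed.

Section continued_fractions.
Context {R : realType}.
Implicit Types (a b : nat -> nat).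

Definition cf_value a : R := lim (cf_convergent R a n @[n --> \oo]).

Definition cf_shift (n : nat) a : nat -> nat := fun i => a (n + i)%N.

Definition pos_seq a := forall n, (0 < a n)%N.

Lemma pos_seq_shift n a : pos_seq a -> pos_seq (cf_shift n a).
Proof. by move=> a0 i; exact: a0. Qed.

(** By [inv_contraction], a common leading digit turns a gap of at most 1/e into one of at most 1/(e
    + 1); n common digits thus leave at most 1/(n + 1). *)
Lemma cf_convergent_dist a n k : pos_seq a ->
  `|cf_convergent R a n - cf_convergent R a (n + k)| <= n.+1%:R^-1.
Proof.
elim: n a => [|n ih] a a0.
  have /andP[c0 c1] := cf_convergent_itv R (0 + k) a0.
  by rewrite /= sub0r normrN ger0_norm// invr1.
rewrite addSn/= -(natr1 n.+1); apply: inv_contraction.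
- by rewrite ler1n.
- by have /andP[] := cf_convergent_itv R n (fun i => a0 i.+1).
- by have /andP[] := cf_convergent_itv R (n + k) (fun i => a0 i.+1).
- by rewrite ltr0n.
- exact: ih (fun i => a0 i.+1).
Qed.

Lemma cf_convergent_cvg a : pos_seq a ->
  cf_convergent R a n @[n --> \oo] --> cf_value a.
Proof.
move=> a0; apply/cauchy_cvgP/cauchy_exP => e e0.
have [N _ Ne] : \forall n \near \oo, n.+1%:R^-1 < e.
  have : (@harmonic R) n @[n --> \oo] --> (0 : R) by exact: cvg_harmonic.
  move=> /cvgrPdist_lt/(_ e e0); apply: filterS => n /=.
  by rewrite sub0r normrN ger0_norm ?invr_ge0.
exists (cf_convergent R a N); exists N => // n /= Nn.
rewrite -(subnKC Nn) /ball/=; apply: le_lt_trans (cf_convergent_dist _ _ a0) _.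
exact: (Ne N (leqnn N)).
Qed.

Lemma cf_value_itv a : pos_seq a -> 0 <= cf_value a <= 1.
Proof.
move=> a0; have ax := cf_convergent_cvg a0.
have cI n := cf_convergent_itv R n a0.
apply/andP; split.
  by apply: limr_ge; [exact: cvgP ax|near=> n; have /andP[] := cI n].
by apply: limr_le; [exact: cvgP ax|near=> n; have /andP[] := cI n].
Unshelve. all: by end_near. Qed.

Lemma cf_valueE a : pos_seq a ->
  cf_value a = ((a 0%N)%:R + cf_value (cf_shift 1 a))^-1.
Proof.
move=> a0; have a0' := @pos_seq_shift 1 _ a0.
have /andP[v0 _] := cf_value_itv a0'.
have h : cf_convergent R a n.+1 @[n --> \oo] --> ((a 0%N)%:R + cf_value (cf_shift 1 a))^-1.
  apply: cvgV; first by rewrite gt_eqF// ltr_pwDl ?ltr0n.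
  by apply: cvgD; [exact: cvg_cst|exact: cf_convergent_cvg].
by rewrite cvg_shiftS in h; exact: cvg_lim.
Qed.

Lemma cf_value_gt0 a : pos_seq a -> 0 < cf_value a.
Proof.
move=> a0; have /andP[v0 _] := cf_value_itv (@pos_seq_shift 1 _ a0).
by rewrite cf_valueE// invr_gt0 ltr_pwDl ?ltr0n.
Qed.

Lemma cf_value_lt_inv a : pos_seq a -> cf_value a < (a 0%N)%:R^-1.
Proof.
move=> a0; have v0 := cf_value_gt0 (@pos_seq_shift 1 _ a0).
by rewrite cf_valueE// ltf_pV2 ?posrE ?ltrDl// ?addr_gt0// ltr0n.
Qed.

Lemma cf_value_lt1 a : pos_seq a -> cf_value a < 1.
Proof.
move=> a0; apply: (lt_le_trans (cf_value_lt_inv a0)).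
by rewrite invf_le1 ?ltr0n// ler1n.
Qed.

(* Infinite descent on the denominator along the Gauss map. *)
Lemma cf_value_mul_neq_nat q p a : pos_seq a -> (0 < q)%N ->
  cf_value a * q%:R != p%:R.
Proof.
elim/ltn_ind: q p a => q ih p a a0 q0; apply/eqP => ap.
have v0 := cf_value_gt0 a0; have v1 := cf_value_lt1 a0.
have qR : 0 < q%:R :> R by rewrite ltr0n.
have p0 : (0 < p)%N by rewrite -(ltr0n R) -ap mulr_gt0.
have pq : (p < q)%N by rewrite -(ltr_nat R) -ap gtr_pMl.
have a0' := @pos_seq_shift 1 _ a0.
have w0 := cf_value_gt0 a0'.
(* A value p/q has shifted value (q - a_0 p)/p, whose denominator p is smaller than q. *)
have E : cf_value (cf_shift 1 a) * p%:R = q%:R - (a 0%N * p)%:R.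
  have A0 : (a 0%N)%:R + cf_value (cf_shift 1 a) != 0 by rewrite gt_eqF// addr_gt0// ltr0n.
  by rewrite natrM -ap (cf_valueE a0); field.
have le : (a 0%N * p <= q)%N.
  by rewrite -(ler_nat R) -subr_ge0 -E mulr_ge0 ?ltW// ltr0n.
by have /eqP := ih p pq (q - a 0%N * p)%N _ a0' p0; rewrite natrB.
Qed.

Lemma cf_value_irrational a : pos_seq a -> irrational (cf_value a).
Proof.
move=> a0 [r _ rE]; have v0 := cf_value_gt0 a0.
have := cf_value_mul_neq_nat `|numq r|%N a0 (_ : 0 < `|denq r|)%N.
rewrite absz_gt0 denq_neq0 => /(_ isT)/eqP; apply.
have r0 : 0 <= r by rewrite -(ler0q R) rE ltW.
rewrite -rE -[r in ratr r]divq_num_den rmorphM fmorphV/= !ratr_int.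
rewrite !natr_absz !ger0_norm ?numq_ge0 ?denq_ge0//.
by rewrite divfK// intr_eq0 denq_neq0.
Qed.

Lemma partial_quotients_cf_value a : pos_seq a -> partial_quotients (cf_value a) = a.
Proof.
move=> a0; apply/esym/partial_quotientsP.
- exact: cf_value_irrational.
- by rewrite cf_value_gt0 ?cf_value_lt1.
- by split=> //; exact: cf_convergent_cvg.
Qed.

Lemma cf_value_partial_quotients (x : R) : irrational x -> 0 < x < 1 ->
  pos_seq (partial_quotients x) /\ cf_value (partial_quotients x) = x.
Proof.
move=> ix x01; have [+ xE] := (partial_quotientsP (partial_quotients x) ix x01).2 erefl.
by split=> //; exact: cvg_lim.
Qed.

(** This is the identity 1/(A + u) - 1/(A + v) = (v - u)/((A + u)(A + v)) for a common first digit
    A. Iterating it with A <= A + u <= A + 1 gives the two estimates that follow. *)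
Lemma cf_value_dist a b : pos_seq a -> pos_seq b -> a 0%N = b 0%N ->
  `|cf_value a - cf_value b| * (((a 0%N)%:R + cf_value (cf_shift 1 a)) *
    ((a 0%N)%:R + cf_value (cf_shift 1 b))) =
  `|cf_value (cf_shift 1 a) - cf_value (cf_shift 1 b)|.
Proof.
move=> a0 b0 ab; rewrite (cf_valueE a0) (cf_valueE b0) -ab.
have u0 := cf_value_gt0 (@pos_seq_shift 1 _ a0).
have v0 := cf_value_gt0 (@pos_seq_shift 1 _ b0).
move: (cf_value _) (cf_value _) u0 v0 => u v u0 v0.
have A0 : 0 < (a 0%N)%:R :> R by rewrite ltr0n.
rewrite -[X in _ * X]ger0_norm; last by rewrite mulr_ge0 ?addr_ge0 ?ltW.
rewrite -normrM distrC; congr `|_|.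
by field; rewrite !gt_eqF ?addr_gt0.
Qed.

Lemma cf_value_dist_le a b n : pos_seq a -> pos_seq b ->
  (forall i, (i < n)%N -> a i = b i) ->
  `|cf_value a - cf_value b| * \prod_(i < n) (a i)%:R ^+ 2 <=
  `|cf_value (cf_shift n a) - cf_value (cf_shift n b)|.
Proof.
elim: n a b => [|n ih] a b a0 b0 ab; first by rewrite big_ord0 mulr1.
have a1 := @pos_seq_shift 1 _ a0; have b1 := @pos_seq_shift 1 _ b0.
apply: le_trans (ih _ _ a1 b1 (fun i => ab i.+1)).
rewrite big_ord_recl mulrA ler_wpM2r//; first by apply: prodr_ge0 => *; exact: sqr_ge0.
rewrite -cf_value_dist ?ab// ler_wpM2l// expr2.
by rewrite ler_pM ?ler0n// lerDl ltW ?cf_value_gt0.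
Qed.

Lemma cf_value_dist_ge a b n : pos_seq a -> pos_seq b ->
  (forall i, (i < n)%N -> a i = b i) ->
  `|cf_value (cf_shift n a) - cf_value (cf_shift n b)| <=
  `|cf_value a - cf_value b| * \prod_(i < n) ((a i)%:R + 1) ^+ 2.
Proof.
elim: n a b => [|n ih] a b a0 b0 ab; first by rewrite big_ord0 mulr1.
have a1 := @pos_seq_shift 1 _ a0; have b1 := @pos_seq_shift 1 _ b0.
apply: (le_trans (ih _ _ a1 b1 (fun i => ab i.+1))).
rewrite big_ord_recl mulrA ler_wpM2r//; first by apply: prodr_ge0 => *; exact: sqr_ge0.
rewrite -cf_value_dist ?ab// ler_wpM2l// expr2.
by rewrite ler_pM ?addr_ge0 ?ler0n ?(ltW (cf_value_gt0 _))// lerD2l ltW ?cf_value_lt1.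
Qed.

(* Since both tails are at most 1/2, the values 1 / (a_0 + u) and 1 / (b_0 + v)
   are separated as soon as a_0 and b_0 differ. *)
Lemma cf_value_sep a b : pos_seq a -> pos_seq b ->
  (1 < a 1)%N -> (1 < b 1)%N -> a 0%N != b 0%N ->
  `|(a 0%N)%:R - (b 0%N)%:R| <=
  2 * (((a 0%N)%:R + 1) * ((b 0%N)%:R + 1)) * `|cf_value a - cf_value b|.
Proof.
move=> a0 b0 a1 b1 ab; rewrite (cf_valueE a0) (cf_valueE b0).
have half c : pos_seq c -> (1 < c 0)%N -> 0 < cf_value c < 2^-1.
  move=> c0 c1; rewrite cf_value_gt0//= (lt_le_trans (cf_value_lt_inv c0))//.
  by rewrite lef_pV2 ?posrE ?ltr0n ?ler_nat.
have /andP[u0 u1] := half _ (@pos_seq_shift 1 _ a0) a1.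
have /andP[v0 v1] := half _ (@pos_seq_shift 1 _ b0) b1.
move: (cf_value _) (cf_value _) u0 u1 v0 v1 => v u u0 u1 v0 v1.
have A0 : 0 < (a 0%N)%:R :> R by rewrite ltr0n.
have B0 : 0 < (b 0%N)%:R :> R by rewrite ltr0n.
have D1 := natr_dist_ge1 (R := R) ab.
move: (a 0%N)%:R (b 0%N)%:R A0 B0 D1 => x y A0 B0 D1.
have -> : (x + u)^-1 - (y + v)^-1 = ((y + v) - (x + u)) / ((x + u) * (y + v)).
  by field; rewrite !gt_eqF ?addr_gt0.
have xu0 : 0 < x + u by rewrite addr_gt0.
have yv0 : 0 < y + v by rewrite addr_gt0.
rewrite normrM normfV (gtr0_norm (mulr_gt0 xu0 yv0)) [leRHS]mulrA ler_pdivlMr ?mulr_gt0//.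
(* Since |u - v| <= 1/2 <= |x - y|/2, the tails cancel at most half of the gap between the
   digits. *)
have h : `|x - y| <= 2 * `|y + v - (x + u)|.
  have : `|u - v| <= 2^-1 by rewrite ler_norml; lra.
  have : `|x - y| <= `|y + v - (x + u)| + `|u - v|.
    rewrite [X in _ <= X + _]distrC.
    have -> : x - y = (x + u - (y + v)) - (u - v) by ring.
    exact: ler_normB.
  by lra.
rewrite [leRHS](_ : _ = (2 * `|y + v - (x + u)|) * ((x + 1) * (y + 1))); last by ring.
apply: ler_pM => //; first by rewrite mulr_ge0 ?ltW.
by apply: ler_pM; rewrite ?ltW ?lerD2l ?ltW//; lra.
Qed.
End continued_fractions.

(** * Growth of phi and of the partial quotients *)

Section growth.
Context {R : realType}.

(** Bernoulli's inequality for the base 1 + (alpha - 1). *)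
Lemma expr_ge_linear (alpha : R) n : 1 <= alpha -> 1 + n%:R * (alpha - 1) <= alpha ^+ n.
Proof.
move=> a1; elim: n => [|n ih]; first by rewrite mul0r addr0 expr0.
have n0 : 0 <= n%:R :> R by [].
rewrite exprS -natr1; have : alpha * (1 + n%:R * (alpha - 1)) <= alpha * alpha ^+ n.
  by rewrite ler_wpM2l// (le_trans ler01).
apply: le_trans; have : 0 <= n%:R * (alpha - 1) ^+ 2 by rewrite mulr_ge0// sqr_ge0.
by rewrite expr2; lra.
Qed.

(** Linear growth of alpha^n is enough: writing the exponential as a cube bounds it below by (e (n +
    1))^3, which exceeds K (n + 1)^2 once e^3 (n + 1) >= K. *)
Lemma expR_expr_dominates (alpha c K : R) : 1 < alpha -> 0 < c ->
  \forall n \near \oo, K * n.+1%:R ^+ 2 <= expR (c * alpha ^+ n).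
Proof.
move=> a1 c0; pose d := Num.min 1 (alpha - 1).
have d0 : 0 < d by rewrite lt_min ltr01 subr_gt0.
pose e := c * d / 3; have e0 : 0 < e by rewrite !mulr_gt0 ?invr_gt0.
near=> n.
have n0 : 0 <= n%:R :> R by [].
have dn : d * n.+1%:R <= alpha ^+ n.
  apply: le_trans (expr_ge_linear n (ltW a1)); rewrite -natr1 mulrDr mulr1 addrC.
  rewrite lerD//; first by rewrite /d ge_min lexx.
  by rewrite mulrC ler_wpM2l// /d ge_min lexx orbT.
have -> : c * alpha ^+ n = (c * alpha ^+ n / 3) * 3 by rewrite divfK.
rewrite expRM_natr.
have en : e * n.+1%:R <= expR (c * alpha ^+ n / 3).
  apply: le_trans (expR_ge1Dx _); rewrite ler_wpDl// /e.
  rewrite mulrAC ler_wpM2r ?invr_ge0// -mulrA ler_wpM2l// ltW//.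
apply: (@le_trans _ _ ((e * n.+1%:R) ^+ 3)); last first.
  by rewrite lerXn2r// nnegrE ?expR_ge0// mulr_ge0 ?(ltW e0).
rewrite exprMn [n.+1%:R ^+ 3]exprS mulrA ler_wpM2r ?sqr_ge0//.
rewrite mulrC -ler_pdivrMr ?exprn_gt0//; apply: ltW.
near: n; exists (Num.truncn (K / e ^+ 3)) => // n /= le_n.
by apply: lt_le_trans (truncnS_gt _) _; rewrite ler_nat.
Unshelve. all: by end_near. Qed.

Lemma expR_expr_ratio_cvg0 (alpha : R) : 1 < alpha ->
  expR (alpha ^+ n) / expR (alpha ^+ n.+1) @[n --> \oo] --> (0 : R).
Proof.
move=> a1; apply/cvgrPdist_le => e e0.
have c0 : 0 < alpha - 1 by rewrite subr_gt0.
near=> n.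
rewrite sub0r normrN ger0_norm; last by rewrite divr_ge0 ?expR_ge0.
rewrite -expRN -expRD exprS.
have -> : alpha ^+ n - alpha * alpha ^+ n = - ((alpha - 1) * alpha ^+ n) by ring.
rewrite expRN -[e]invrK lef_pV2 ?posrE ?expR_gt0 ?invr_gt0//.
apply: (@le_trans _ _ (e^-1 * n.+1%:R ^+ 2)).
  by rewrite ler_peMr ?invr_ge0 ?(ltW e0)// expr_ge1// ler1n.
by near: n; exact: expR_expr_dominates.
Unshelve. all: by end_near. Qed.

(** * Passing between sums and their last terms *)

Section increments.
Variables (phi S : nat -> R).
Hypothesis phi0 : forall n, 0 < phi n.
Hypothesis phi_ratio : phi n / phi n.+1 @[n --> \oo] --> (0 : R).

(** With r_n = S_n/phi_n, this is a recursion r_(n+1) = p_n + r_n t_n where t_n -> 0. As soon as r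
    is bounded, r_(n+1) and p_n have the same limit. *)
Lemma increment_ratioE n : S n.+1 / phi n.+1 =
  (S n.+1 - S n) / phi n.+1 + S n / phi n * (phi n / phi n.+1).
Proof. by field; rewrite !gt_eqF. Qed.

Lemma increment_ratio_cvg : S n / phi n @[n --> \oo] --> (1 : R) ->
  (S n.+1 - S n) / phi n.+1 @[n --> \oo] --> (1 : R).
Proof.
move=> S1.
rewrite (_ : (fun n => _) = fun n =>
  S n.+1 / phi n.+1 - S n / phi n * (phi n / phi n.+1)); last first.
  by apply/funext => n; rewrite increment_ratioE addrK.
rewrite -[X in _ --> X](subr0 1) -[X in _ - X](mulr0 1).
by apply: cvgB; [rewrite (cvg_shiftS (fun n => S n / phi n))|exact: cvgM].
Qed.

Lemma cvg_increment_ratio : (forall n, 0 <= S n) ->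
  (S n.+1 - S n) / phi n.+1 @[n --> \oo] --> (1 : R) ->
  S n / phi n @[n --> \oo] --> (1 : R).
Proof.
move=> S0 p1.
have r0 n : 0 <= S n / phi n by rewrite divr_ge0// ltW.
have t0 n : 0 <= phi n / phi n.+1 by rewrite divr_ge0// ltW.
have [N _ Nt] : \forall n \near \oo,
    (S n.+1 - S n) / phi n.+1 <= 2 /\ phi n / phi n.+1 <= 2^-1.
  near=> n; split; near: n.
  - by apply: (cvgr_le _ p1); rewrite ltrDl.
  - by apply: (cvgr_le _ phi_ratio); rewrite invr_gt0.
(* Once p_n <= 2 and t_n <= 1/2, any B >= 4 is preserved by the recursion, because 2 + B/2 <= B. *)
pose B := Num.max 4 (S N / phi N).
have B4 : 4 <= B by rewrite le_max lexx.
have rB k : S (N + k)%N / phi (N + k)%N <= B.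
  elim: k => [|k ih]; first by rewrite addn0 le_max lexx orbT.
  rewrite addnS increment_ratioE; have [h1 h2] := Nt (N + k)%N (leq_addr _ _).
  have : S (N + k)%N / phi (N + k)%N * (phi (N + k)%N / phi (N + k).+1) <= B * 2^-1.
    by rewrite ler_pM.
  by lra.
have st : S n / phi n * (phi n / phi n.+1) @[n --> \oo] --> (0 : R).
  apply: (@squeeze_cvgr _ _ _ _ (fun=> 0) (fun n => B * (phi n / phi n.+1))).
  - near=> n; rewrite mulr_ge0//= ler_wpM2r//.
    have Nn : (N <= n)%N by near: n; exists N.
    by rewrite -(subnKC Nn).
  - exact: cvg_cst.
  - by rewrite -(mulr0 B); apply: cvgM => //; exact: cvg_cst.
rewrite -(cvg_shiftS (fun n => S n / phi n)).
rewrite (_ : (fun n => _) = fun n =>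
  (S n.+1 - S n) / phi n.+1 + S n / phi n * (phi n / phi n.+1)); last first.
  by apply/funext => n; rewrite increment_ratioE.
have := cvgD p1 st; rewrite addr0 ; exact.
Unshelve. all: by end_near. Qed.
End increments.

Lemma cf_sum_prodS (x : R) n : ((cf_sum_prod x n.+1)%:R - (cf_sum_prod x n)%:R =
  (partial_quotients x n)%:R * (partial_quotients x n.+1)%:R :> R).
Proof. by rewrite /cf_sum_prod big_ord_recr/= natrD natrM addrC addKr. Qed.

(** Digits being indexed from 0, the product at n is the last term of S_(n+1), whence the comparison
    with [phi n.+1]. *)
Lemma cf_level_setP (phi : nat -> R) (x : R) : (forall n, 0 < phi n) ->
  phi n / phi n.+1 @[n --> \oo] --> (0 : R) ->
  irrational x -> 0 < x < 1 ->
  cf_level_set phi x <->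
  (partial_quotients x n)%:R * (partial_quotients x n.+1)%:R / phi n.+1
    @[n --> \oo] --> (1 : R).
Proof.
move=> phi0 phir ix x01.
have E : (fun n => ((cf_sum_prod x n.+1)%:R - (cf_sum_prod x n)%:R) / phi n.+1) =
    (fun n => (partial_quotients x n)%:R * (partial_quotients x n.+1)%:R / phi n.+1).
  by apply/funext => n; rewrite cf_sum_prodS.
split=> [[_ _ h]|h].
  by rewrite -E; exact: (@increment_ratio_cvg phi (fun n => (cf_sum_prod x n)%:R)).
split=> //; apply: (@cvg_increment_ratio phi (fun n => (cf_sum_prod x n)%:R)) => //.
by rewrite E.
Qed.
End growth.

(** * The lower bound *)

Section mixed_radix.
Context {R : realType}.
Variable M : nat -> nat.
Hypothesis M_gt1 : forall n, (1 < M n)%N.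

(** For t in [0, 1[ this is the rescaled remainder of the Cantor series t = sum_n d_n/(M_0 ... M_n),
    with d_n given by [radix_digit]. *)
Fixpoint radix_tail (t : R) (n : nat) : R :=
  if n is m.+1 then (M m)%:R * radix_tail t m - (Num.truncn ((M m)%:R * radix_tail t m))%:R
  else t.

Definition radix_digit (t : R) n : nat := Num.truncn ((M n)%:R * radix_tail t n).

Lemma radix_tail_itv t n : 0 <= t < 1 -> 0 <= radix_tail t n < 1.
Proof.
move=> t01; elim: n => [//|n /andP[ih _]] /=.
have /truncn_itv/andP[h1 h2] : 0 <= (M n)%:R * radix_tail t n by rewrite mulr_ge0.
by move: h1 h2; rewrite -natr1; lra.
Qed.

Lemma radix_digit_lt t n : 0 <= t < 1 -> (radix_digit t n < M n)%N.
Proof.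
move=> /(radix_tail_itv n)/andP[r0 r1].
rewrite -(ltr_nat R) /radix_digit.
have /truncn_itv/andP[h1 _] : 0 <= (M n)%:R * radix_tail t n by rewrite mulr_ge0.
by rewrite (le_lt_trans h1)// gtr_pMr// ltr0n ltnW.
Qed.

Lemma radix_tail_dist t u n :
  (forall i, (i < n)%N -> radix_digit t i = radix_digit u i) ->
  `|radix_tail t n - radix_tail u n| = `|t - u| * \prod_(i < n) (M i)%:R.
Proof.
elim: n => [|n ih] tu; first by rewrite big_ord0 mulr1.
rewrite big_ord_recr/= mulrA -ih => [|i /ltnW]; last exact: tu.
have := tu n (leqnn _); rewrite /radix_digit => ->.
by rewrite opprB addrA subrK -mulrBr normrM mulrC normr_nat.
Qed.

Lemma radix_digit_neq t u : 0 <= t < 1 -> 0 <= u < 1 -> t != u ->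
  exists n, (forall i, (i < n)%N -> radix_digit t i = radix_digit u i) /\
            radix_digit t n != radix_digit u n.
Proof.
move=> t01 u01 tu; have [[n nP]|nodiff] := pselect (exists n, radix_digit t n != radix_digit u n).
  have [m mP mmin] := ex_minnP (ex_intro (fun n => radix_digit t n != radix_digit u n) n nP).
  exists m; split=> // i im; apply/eqP; apply: contraTT im => /mmin.
  by rewrite -leqNgt.
exfalso; have same i : radix_digit t i = radix_digit u i.
  by apply/eqP/negPn/negP => h; apply: nodiff; exists i.
have d0 : 0 < `|t - u| by rewrite normr_gt0 subr_eq0.
(* If all digits agreed, |t - u| times the product of n radices, at least 2^n >= n + 1, would stay
   below 1; this n makes (n + 1) |t - u| > 1. *)
pose n := Num.truncn `|t - u|^-1.
have lt1 : `|t - u| * \prod_(i < n) (M i)%:R < 1.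
  rewrite -radix_tail_dist// ltr_norml.
  by have := radix_tail_itv n t01; have := radix_tail_itv n u01; lra.
have : n.+1%:R <= \prod_(i < n) (M i)%:R :> R.
  apply: (@le_trans _ _ (2 ^ n)%:R); first by rewrite ler_nat ltn_expl.
  rewrite natrX -[in leLHS](card_ord n) -prodr_const.
  by apply: ler_prod => i _; rewrite ler0n ler_nat M_gt1.
apply/negP; rewrite -ltNge; apply: lt_trans (truncnS_gt _).
by rewrite -[ltRHS]mul1r ltr_pdivlMr// mulrC.
Qed.

(** The rescaled remainders at n, multiplied by M_n, differ by the gap between the digits plus a
    difference of numbers in [0, 1[; the latter is at most 1, hence at most the gap. *)
Lemma radix_dist_le t u n : 0 <= t < 1 -> 0 <= u < 1 ->
  (forall i, (i < n)%N -> radix_digit t i = radix_digit u i) ->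
  radix_digit t n != radix_digit u n ->
  `|t - u| * (\prod_(i < n) (M i)%:R * (M n)%:R) <=
    2 * `|(radix_digit t n)%:R - (radix_digit u n)%:R|.
Proof.
move=> t01 u01 tu dn; rewrite mulrA -radix_tail_dist//.
have D1 : 1 <= `|(radix_digit t n)%:R - (radix_digit u n)%:R| :> R.
  exact: natr_dist_ge1.
have := radix_tail_itv n.+1 t01; have := radix_tail_itv n.+1 u01.
rewrite /= -/(radix_digit t n) -/(radix_digit u n) => ru rt.
rewrite -[X in _ * X]ger0_norm// -normrM mulrBl.
move: rt ru; rewrite ![(M n)%:R * _]mulrC.
move: (radix_digit t n)%:R (radix_digit u n)%:R D1 => p q D1.
move: (radix_tail t n * _) (radix_tail u n * _) => x y rx ry.
apply: (@le_trans _ _ (`|p - q| + 1)); last by lra.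
have -> : x - y = (p - q) + ((x - p) - (y - q)) by ring.
by apply: (le_trans (ler_normD _ _)); rewrite lerD2l ler_norml; lra.
Qed.
End mixed_radix.

Lemma eventually_nonincreasing_bounded {R : realType} (r : nat -> R) :
  (forall n, 0 <= r n) -> (\forall n \near \oo, r n.+1 <= r n) ->
  exists2 K, 0 < K & forall n, r n <= K.
Proof.
move=> r0 [N _ rN].
have s0 : 0 <= \sum_(i < N.+1) r i by apply: sumr_ge0.
have small n : (n <= N)%N -> r n <= \sum_(i < N.+1) r i.
  move=> nN; rewrite (bigD1 (Ordinal (nN : n < N.+1)%N))//= lerDl.
  exact: sumr_ge0.
exists (1 + \sum_(i < N.+1) r i); first by rewrite ltr_pwDl.
move=> n; apply: (@le_trans _ _ (\sum_(i < N.+1) r i)); last by rewrite lerDr.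
have [/small//|Nn] := leqP n N.
rewrite -(subnKC (ltnW Nn)); elim: (n - N)%N => [|k ih].
  by rewrite addn0; exact: small.
by rewrite addnS (le_trans _ ih)//; apply: rN; exact: leq_addr.
Qed.

(** * A Cantor set inside the level set *)

Section cantor_subset.
Context {R : realType}.
Variable alpha : R.
Hypothesis alpha_gt1 : 1 < alpha.

Let alpha0 : 0 < alpha. Proof. exact: lt_trans alpha_gt1. Qed.
Let alpha1 : 0 < 1 + alpha. Proof. by rewrite addr_gt0. Qed.

(* Digits being indexed from 0, this is A_(n+1) in the notation of the header. *)
Definition digit_size n : R := expR (alpha ^+ n.+1 / (1 + alpha)).

Local Notation A := digit_size.

Lemma digit_size_ge1 n : 1 <= A n.
Proof. by rewrite -expR0 ler_expR divr_ge0 ?exprn_ge0 ?ltW. Qed.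

Let A0 n : 0 < A n. Proof. exact: expR_gt0. Qed.

Lemma digit_sizeM n : A n * A n.+1 = expR (alpha ^+ n.+1).
Proof.
rewrite -expRD -mulrDl [alpha ^+ n.+2]exprS; congr expR.
by field; rewrite gt_eqF.
Qed.

(** Division by n + 1 keeps the digits asymptotic to [A n] while costing only a polynomial factor in
    the number of choices. Adding 2 guarantees at least two choices. *)
Definition digit_count n : nat := (Num.truncn (A n / n.+1%:R)).+2.

(** Adding 2 puts the digit above [A n] and above 1, the latter being required by [cf_value_sep]. *)
Definition cantor_digits (t : R) n : nat :=
  ((Num.truncn (A n)).+2 + radix_digit digit_count t n)%N.

Local Notation M := digit_count.

Let An n : 0 <= A n / n.+1%:R <= A n.
Proof.
rewrite divr_ge0 ?(ltW (A0 n))//= ler_pdivrMr// ler_peMr ?(ltW (A0 n))//.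
by rewrite ler1n.
Qed.

Lemma digit_count_ge n : A n / n.+1%:R <= (M n)%:R.
Proof.
apply: ltW; apply: lt_le_trans (truncnS_gt _) _.
by rewrite ler_nat.
Qed.

Lemma digit_count_le n : (M n)%:R <= 3 * A n.
Proof.
rewrite /digit_count -addn2 natrD; move: (An n) (digit_size_ge1 n).
move: (A n / _) => q /andP[/truncn_itv/andP[+ _]].
by move: (Num.truncn q)%:R => p; lra.
Qed.

Lemma cantor_digits_gt1 t n : (1 < cantor_digits t n)%N.
Proof. by []. Qed.

Lemma cantor_digits_pos t : pos_seq (cantor_digits t).
Proof. by move=> n; rewrite (ltn_trans _ (cantor_digits_gt1 t n)). Qed.

Lemma cantor_digits_ge t n : A n <= (cantor_digits t n)%:R.
Proof.
apply: ltW; apply: lt_le_trans (truncnS_gt _) _.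
by rewrite ler_nat /cantor_digits addSnnS leq_addr.
Qed.

Lemma cantor_digits_le t n : 0 <= t < 1 ->
  (cantor_digits t n)%:R <= A n + A n / n.+1%:R + 3.
Proof.
move=> t01; have : (radix_digit M t n <= (Num.truncn (A n / n.+1%:R)).+1)%N.
  by rewrite -ltnS; exact: radix_digit_lt.
rewrite -(ler_nat R) /cantor_digits natrD -addn1 -addn2 !natrD.
have /andP[/truncn_itv/andP[+ _] _] := An n.
have /truncn_itv/andP[+ _] := ltW (A0 n).
move: (A n / _) (Num.truncn (A n))%:R => q p.
by move: (Num.truncn q)%:R => r; lra.
Qed.

Lemma cantor_digits_le6 t n : 0 <= t < 1 -> (cantor_digits t n)%:R + 1 <= 6 * A n.
Proof.
move=> /(cantor_digits_le n); have /andP[_] := An n; have := digit_size_ge1 n.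
by move: (A n / _) => q; lra.
Qed.

Lemma digit_size_dominates (K : R) : \forall n \near \oo, K * n.+1%:R ^+ 2 <= A n.
Proof.
have c0 : 0 < alpha / (1 + alpha) by rewrite divr_gt0.
have := expR_expr_dominates K alpha_gt1 c0; apply: filterS => n.
by rewrite /digit_size [alpha ^+ n.+1]exprS mulrAC.
Qed.

Lemma cantor_digits_ratio_cvg t : 0 <= t < 1 ->
  (cantor_digits t n)%:R / A n @[n --> \oo] --> (1 : R).
Proof.
move=> t01.
(* The factor 4 is 1 for the range of the digits plus 3 for the rounding, as eventually 1 <= A_n/(n
   + 1). *)
apply: (@squeeze_cvgr _ _ _ _ (fun=> 1) (fun n => 1 + 4 * (@harmonic R) n)).
- near=> n; apply/andP; split.
    by rewrite ler_pdivlMr// mul1r cantor_digits_ge.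
  rewrite ler_pdivrMr//; apply: (le_trans (cantor_digits_le n t01)).
  have : 1 * n.+1%:R ^+ 2 <= A n by near: n; exact: digit_size_dominates.
  rewrite mul1r expr2 -ler_pdivlMr// /harmonic/= => h.
  have -> : (1 + 4 * n.+1%:R^-1) * A n = A n + 4 * (A n / n.+1%:R) by ring.
  have : 1 <= n.+1%:R :> R by rewrite ler1n.
  by move: (A n / _) h => q; lra.
- exact: cvg_cst.
- rewrite -[X in _ --> X]addr0 -(mulr0 4).
  by apply: cvgD; [exact: cvg_cst|apply: cvgM; [exact: cvg_cst|exact: cvg_harmonic]].
Unshelve. all: by end_near. Qed.

Lemma cantor_digits_level_set t : 0 <= t < 1 ->
  cf_level_set (fun n => expR (alpha ^+ n)) (cf_value (cantor_digits t) : R).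
Proof.
move=> t01; have a0 := cantor_digits_pos t.
apply/cf_level_setP.
- by move=> n; exact: expR_gt0.
- exact: expR_expr_ratio_cvg0.
- exact: cf_value_irrational.
- by rewrite cf_value_gt0 ?cf_value_lt1.
rewrite partial_quotients_cf_value//.
have c := cantor_digits_ratio_cvg t01.
have : (cantor_digits t n)%:R / A n * ((cantor_digits t n.+1)%:R / A n.+1)
    @[n --> \oo] --> (1 * 1 : R).
  by apply: cvgM => //; rewrite (cvg_shiftS (fun n => (cantor_digits t n)%:R / A n)).
rewrite mulr1; apply: cvg_trans; apply: near_eq_cvg; near=> n.
by rewrite -digit_sizeM; field; rewrite !gt_eqF.
Unshelve. all: by end_near. Qed.

(** [P n] counts the words of length n. Points whose digits first differ at index n, by D, will be
    at distance at least D/(H_n M_n). *)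
Let P n : R := \prod_(i < n) (M i)%:R.
Let G n : R := \prod_(i < n) (6 * A i) ^+ 2.
Let H n : R := 2 * (G n * (6 * A n) ^+ 2) / (M n)%:R.

Let M0 n : 0 < (M n)%:R :> R. Proof. by rewrite ltr0n. Qed.
Let P0 n : 0 < P n. Proof. exact: prodr_gt0. Qed.
Let G0 n : 0 < G n. Proof. by apply: prodr_gt0 => i _; rewrite exprn_gt0// mulr_gt0. Qed.
Let H0 n : 0 < H n.
Proof. by rewrite divr_gt0// mulr_gt0// mulr_gt0// exprn_gt0// mulr_gt0. Qed.

Let HS n : H n.+1 = H n * ((6 * A n.+1) ^+ 2 * (M n)%:R / (M n.+1)%:R).
Proof. by rewrite /H /G big_ord_recr/=; field; rewrite !gt_eqF. Qed.

(** From n to n + 1, the ratio H_n^s/P_n is multiplied by X^s/M_n, where X is at most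
    exp(alpha^(n+1)) up to a linear factor and M_n is at least exp(alpha^(n+1)/(1 + alpha))/(n + 1).
    As s < 1/(1 + alpha), this is eventually at most 1. *)
Lemma separation_scale_bounded (s : R) : 0 <= s -> s < 1 / (1 + alpha) ->
  exists2 K, 0 < K & forall n, H n `^ s <= K * P n.
Proof.
move=> s0 sa.
suff [K K0 HK] : exists2 K, 0 < K & forall n, H n `^ s / P n <= K.
  by exists K => // n; rewrite -ler_pdivrMr.
apply: eventually_nonincreasing_bounded.
  by move=> n; rewrite divr_ge0 ?powR_ge0 ?ltW.
have s1 : s <= 1.
  apply/ltW/(lt_le_trans sa); rewrite ler_pdivrMr// mul1r lerDl ltW//.
have c0 : 0 < alpha * (1 / (1 + alpha) - s) by rewrite mulr_gt0// subr_gt0.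
near=> n.
have Mn0 : 0 < (M n)%:R :> R by [].
set X := (6 * A n.+1) ^+ 2 * (M n)%:R / (M n.+1)%:R.
have X0 : 0 <= X by apply: divr_ge0 => //; apply: mulr_ge0 => //; exact: sqr_ge0.
suff XM : X `^ s <= (M n)%:R.
  rewrite HS -/X powRM ?(ltW (H0 n))// /P big_ord_recr/= -/(P n) invfM mulrACA.
  by rewrite ler_piMr ?divr_ge0 ?powR_ge0 ?(ltW (P0 n))// ler_pdivrMr// mul1r.
(* Here 108 = 36 * 3, from the square of 6 and from M_n <= 3 A_n; the factor n + 2 comes from
   M_(n+1) >= A_(n+1)/(n + 2). *)
have XE : X <= 108 * n.+2%:R * expR (alpha ^+ n.+1).
  rewrite /X ler_pdivrMr//.
  apply: (@le_trans _ _ ((6 * A n.+1) ^+ 2 * (3 * A n))).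
    by rewrite ler_wpM2l ?sqr_ge0// digit_count_le.
  apply: (@le_trans _ _ (108 * n.+2%:R * expR (alpha ^+ n.+1) * (A n.+1 / n.+2%:R))); last first.
    by rewrite ler_wpM2l ?digit_count_ge// !mulr_ge0 ?expR_ge0.
  by rewrite -digit_sizeM le_eqVlt; apply/orP; left; apply/eqP; field.
apply: le_trans (digit_count_ge n).
rewrite ler_pdivlMr//.
apply: (@le_trans _ _ (108 * n.+2%:R * expR (s * alpha ^+ n.+1) * n.+1%:R)).
  rewrite ler_wpM2r//.
  apply: (@le_trans _ _ ((108 * n.+2%:R * expR (alpha ^+ n.+1)) `^ s)).
    by rewrite ge0_ler_powR// nnegrE !mulr_ge0 ?expR_ge0.
  rewrite powRM ?mulr_ge0 ?expR_ge0// -expRM [alpha ^+ n.+1 * s]mulrC.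
  rewrite ler_wpM2r ?expR_ge0// ler1_powR//.
  have : 1 <= n.+2%:R :> R by rewrite ler1n.
  by lra.
(* The constant is 2 * 108, since n + 2 <= 2 (n + 1). *)
have big : 216 * n.+1%:R ^+ 2 <= expR (alpha * (1 / (1 + alpha) - s) * alpha ^+ n).
  by near: n; exact: expR_expr_dominates.
have -> : A n = expR (alpha * (1 / (1 + alpha) - s) * alpha ^+ n) * expR (s * alpha ^+ n.+1).
  rewrite -expRD; congr expR; rewrite exprS; field; rewrite gt_eqF//.
rewrite mulrAC ler_wpM2r ?expR_ge0//; apply: le_trans big.
rewrite expr2 mulrA ler_wpM2r// -natr1 -[n.+1%:R]natr1.
by have : 0 <= n%:R :> R by []; lra.
Unshelve. all: by end_near. Qed.

(** Let n be the first index where the digits differ, by D, and th = D/M_n <= 1. Then |t - u| P_n <=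
    2 th <= 2 th^s <= 2 (H_n |x - y|)^s <= 2 K P_n |x - y|^s, and P_n cancels. *)
Lemma cantor_map_inverse_holder (s : R) : 0 <= s -> s < 1 / (1 + alpha) ->
  exists2 C, 0 < C & forall t u, 0 <= t < 1 -> 0 <= u < 1 ->
    `|t - u| <= C * `|cf_value (cantor_digits t) - cf_value (cantor_digits u)| `^ s.
Proof.
move=> s0 sa; have [K K0 HK] := separation_scale_bounded s0 sa.
exists (2 * K); first by rewrite mulr_gt0.
move=> t u t01 u01; have [->|tu] := eqVneq t u.
  by rewrite subrr normr0 mulr_ge0 ?powR_ge0// mulr_ge0// ltW.
have M_gt1 i : (1 < M i)%N by [].
have [n [same diff]] := radix_digit_neq M_gt1 t01 u01 tu.
have dist := radix_dist_le t01 u01 same diff.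
set x := cf_value _; set y := cf_value _.
have a0 := cantor_digits_pos t; have b0 := cantor_digits_pos u.
have ab i : (i < n)%N -> cantor_digits t i = cantor_digits u i.
  by move=> /same; rewrite /cantor_digits => ->.
set D := `|(radix_digit M t n)%:R - _| in dist.
have D1 : 1 <= D by exact: natr_dist_ge1.
have DM : D <= (M n)%:R.
  have := radix_digit_lt M_gt1 n t01; have := radix_digit_lt M_gt1 n u01.
  rewrite /D -!(ltr_nat R) => h1 h2; rewrite ler_norml.
  have : 0 <= (radix_digit M t n)%:R :> R by [].
  have : 0 <= (radix_digit M u n)%:R :> R by [].
  by lra.
(* [cf_value_sep] separates the tails from index n on, and [cf_value_dist_ge] carries this over to x
   and y. *)
have Dxy : D <= H n * (M n)%:R * `|x - y|.
  have := cf_value_sep (R := R) (pos_seq_shift n a0) (pos_seq_shift n b0).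
  rewrite /cf_shift !addn0 !addn1 => /(_ isT isT).
  rewrite {1}/cantor_digits eqn_add2l => /(_ diff).
  have -> : (cantor_digits t n)%:R - (cantor_digits u n)%:R =
      (radix_digit M t n)%:R - (radix_digit M u n)%:R :> R.
    by rewrite /cantor_digits !natrD; ring.
  rewrite -/D => /le_trans; apply.
  have c0 v i : 0 <= (cantor_digits v i)%:R + 1 :> R by rewrite addr_ge0// ler0n.
  have := cf_value_dist_ge (R := R) a0 b0 ab; rewrite -/x -/y /cf_shift => h.
  have := cantor_digits_le6 n t01; have := cantor_digits_le6 n u01 => hu ht.
  apply: (@le_trans _ _ (2 * ((6 * A n) * (6 * A n)) * (`|x - y| * G n))).
    apply: ler_pM => //.
      by rewrite ler_wpM2l// ler_pM.
    apply: (le_trans h); rewrite ler_wpM2l//.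
    apply: ler_prod => i _; rewrite sqr_ge0/= lerXn2r ?nnegrE//.
      by rewrite mulr_ge0// ltW.
    exact: cantor_digits_le6.
  by rewrite /H divfK ?gt_eqF// le_eqVlt; apply/orP; left; apply/eqP; ring.
pose th := D / (M n)%:R.
have th01 : 0 < th <= 1.
  by rewrite divr_gt0 ?(lt_le_trans ltr01 D1)//= ler_pdivrMr// mul1r.
have ths : th <= th `^ s.
  apply: ger1_powR => //; apply/ltW/(lt_le_trans sa).
  by rewrite ler_pdivrMr// mul1r lerDl ltW.
have thxy : th `^ s <= K * P n * `|x - y| `^ s.
  apply: (@le_trans _ _ ((H n * `|x - y|) `^ s)).
    apply: ge0_ler_powR => //.
    - by rewrite nnegrE ltW//; case/andP: th01.
    - by rewrite nnegrE mulr_ge0// ltW.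
    - by rewrite /th ler_pdivrMr// mulrAC.
  by rewrite powRM ?(ltW (H0 n))// ler_wpM2r ?powR_ge0.
rewrite -(ler_pM2r (P0 n)).
apply: (@le_trans _ _ (2 * th)).
  by rewrite /th mulrA ler_pdivlMr// -mulrA.
have := le_trans ths thxy; lra.
Qed.

Lemma hausdorff_measure_level_set_neq0 (s : R) : 0 <= s -> s < 1 / (1 + alpha) ->
  hausdorff_measure s (cf_level_set (fun n => expR (alpha ^+ n))) != 0%E.
Proof.
move=> s0 sa; have [C C0 CH] := cantor_map_inverse_holder s0 sa.
exact: (inverse_holder_hausdorff_measure_neq0 s0 C0 cantor_digits_level_set CH).
Qed.
End cantor_subset.

(** * The upper bound *)

Section upper_bound.
Context {R : realType}.
Variable alpha : R.
Hypothesis alpha_gt1 : 1 < alpha.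

Let alpha0 : 0 < alpha. Proof. exact: lt_trans alpha_gt1. Qed.
Let alpha1 : 0 < 1 + alpha. Proof. by rewrite addr_gt0. Qed.

Let phi n : R := expR (alpha ^+ n).
Let phi0 n : 0 < phi n. Proof. exact: expR_gt0. Qed.

(** Only part of the usual cylinder of [w]: the growth constraint from index m on is imposed too,
    and it controls the digits that follow [w]. *)
Definition cylinder (m : nat) (w : seq nat) : set R :=
  [set x | exists a, [/\ pos_seq a, (forall i, (i < size w)%N -> a i = nth 0%N w i),
    x = cf_value a &
    forall i, (m <= i)%N -> phi i.+1 / 2 <= (a i)%:R * (a i.+1)%:R <= 2 * phi i.+1]].

(* 1 / cylinder_scale w bounds the length of the cylinder: on it the next digit
   is at least phi(n) / (2 w_n), where n is the length of w. *)
Definition cylinder_scale (w : seq nat) : R :=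
  \prod_(b <- w) b%:R ^+ 2 * phi (size w) / (2 * (last 0%N w)%:R).

Let scale_step n : R := phi n.+1 * phi n.+2 / 4.

Let scale_step_gt0 n : 0 < scale_step n.
Proof. by rewrite divr_gt0// mulr_gt0. Qed.

(** Since m < size w, the constraint applies to the index of the last digit of [w], hence to its
    product with the next digit. *)
Lemma cylinder_rcons m w x : (m < size w)%N -> cylinder m w x ->
  exists b, [/\ (0 < b)%N, cylinder m (rcons w b) x &
    phi (size w) / 2 <= (last 0%N w)%:R * b%:R <= 2 * phi (size w)].
Proof.
move=> mw [a [a0 aw xE ap]]; exists (a (size w)); split=> //.
  exists a; split=> // i; rewrite size_rcons ltnS leq_eqVlt nth_rcons.
  by case/predU1P => [->|iw]; rewrite ?ltnn ?eqxx// iw aw.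
have sw : (0 < size w)%N by exact: leq_ltn_trans mw.
have := ap (size w).-1; rewrite prednK// aw ?prednK// nth_last; apply.
by rewrite -ltnS prednK.
Qed.

Lemma cylinder_digits_gt0 m w : cylinder m w !=set0 -> forall b, b \in w -> (0 < b)%N.
Proof.
move=> [x [a [a0 aw _ _]]] b /(nthP 0%N)[i iw <-].
by rewrite -aw// a0.
Qed.

Lemma last_mem m w : (m < size w)%N -> last 0%N w \in w.
Proof. by case: w => //= b w _; exact: mem_last. Qed.

Lemma cylinder_scale_gt0 m w : (m < size w)%N -> cylinder m w !=set0 ->
  0 < cylinder_scale w.
Proof.
move=> mw /cylinder_digits_gt0 w0.
have l0 : (0 < last 0%N w)%N by apply: w0; exact: last_mem mw.
rewrite divr_gt0 ?mulr_gt0 ?ltr0n// big_seq.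
by apply: prodr_gt0 => b /w0 b0; rewrite exprn_gt0// ltr0n.
Qed.

Lemma cylinder_dist m w x y : (m < size w)%N -> cylinder m w x -> cylinder m w y ->
  `|x - y| <= (cylinder_scale w)^-1.
Proof.
move=> mw xw yw.
have s0 : 0 < cylinder_scale w by apply: cylinder_scale_gt0 mw _; exists x.
have l0 : (0 < last 0%N w)%N.
  by apply: (@cylinder_digits_gt0 m w); [exists x|exact: last_mem mw].
(* The tail after [w] is below the inverse of its first digit, which is at least phi(n)/(2 l) for l
   the last digit of [w]. *)
have tail a : pos_seq a -> (forall i, (i < size w)%N -> a i = nth 0%N w i) ->
    (forall i, (m <= i)%N -> phi i.+1 / 2 <= (a i)%:R * (a i.+1)%:R <= 2 * phi i.+1) ->
    0 < (cf_value (cf_shift (size w) a) : R) < 2 * (last 0%N w)%:R / phi (size w).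
  move=> a0 aw ap; have a0' := pos_seq_shift (size w) a0.
  rewrite cf_value_gt0//=; apply: (lt_le_trans (cf_value_lt_inv a0')).
  rewrite /cf_shift addn0.
  have sw : (0 < size w)%N by exact: leq_ltn_trans mw.
  have := ap (size w).-1; rewrite prednK// aw ?prednK// nth_last.
  rewrite -ltnS prednK// => /(_ mw)/andP[h _].
  rewrite -[leRHS]invrK lef_pV2 ?posrE ?ltr0n ?invr_gt0 ?divr_gt0 ?mulr_gt0 ?ltr0n//.
  rewrite invf_div ler_pdivrMr ?mulr_gt0 ?ltr0n//.
  by move: h; rewrite ler_pdivrMr//; lra.
move: xw yw => [a [a0 aw -> ap]] [b [b0 bw -> bp]].
have /andP[u0 u1] := tail a a0 aw ap; have /andP[v0 v1] := tail b b0 bw bp.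
have ab i : (i < size w)%N -> a i = b i by move=> iw; rewrite aw// bw.
have := cf_value_dist_le (R := R) a0 b0 ab.
have -> : \prod_(i < size w) (a i)%:R ^+ 2 = \prod_(c <- w) c%:R ^+ 2 :> R.
  by rewrite (big_nth 0%N) big_mkord; apply: eq_bigr => i _; rewrite aw.
have le : `|cf_value (cf_shift (size w) a) - cf_value (cf_shift (size w) b)| <=
   2 * (last 0%N w)%:R / phi (size w) by rewrite ler_norml; lra.
move=> /le_trans/(_ le) h.
rewrite -[leRHS]mul1r ler_pdivlMr// /cylinder_scale.
rewrite -[X in X * phi _]mulr1 !mulrA ler_pdivrMr ?mulr_gt0 ?ltr0n// mul1r mulr1.
by rewrite -ler_pdivlMr.
Qed.

(** With l the last digit of [w] and n its length, the quotient of the scales is (l b)(b c)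
    phi(n+2)/phi(n), where l b >= phi(n)/2 and b c >= phi(n+1)/2. *)
Lemma cylinder_scale_step m w b c : (m < size w)%N ->
  cylinder m (rcons (rcons w b) c) !=set0 ->
  cylinder_scale w * scale_step (size w) <= cylinder_scale (rcons (rcons w b) c).
Proof.
move=> mw ne; have w0 := cylinder_digits_gt0 ne.
have l0 : (0 < last 0%N w)%N by apply: w0; rewrite mem_rcons inE mem_rcons inE (last_mem mw) !orbT.
have b0 : (0 < b)%N by apply: w0; rewrite mem_rcons inE mem_rcons inE eqxx !orbT.
have c0 : (0 < c)%N by apply: w0; rewrite mem_rcons inE eqxx.
have [x [a [a0 aw _ ap]]] := ne.
have sw : (0 < size w)%N by exact: leq_ltn_trans mw.
rewrite !size_rcons in aw.
have al : a (size w).-1 = last 0%N w.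
  rewrite aw; last by rewrite prednK// leqW.
  by rewrite !nth_rcons size_rcons prednK// leqnSn leqnn nth_last.
have ab : a (size w) = b.
  by rewrite aw ?leqnSn// !nth_rcons size_rcons leqnn ltnn eqxx.
have ac : a (size w).+1 = c.
  by rewrite aw// nth_rcons size_rcons ltnn eqxx.
have := ap (size w).-1; rewrite prednK// al ab -ltnS prednK// => /(_ mw)/andP[h1 _].
have := ap (size w); rewrite ab ac => /(_ (ltnW mw))/andP[h2 _].
rewrite /cylinder_scale /scale_step !size_rcons last_rcons.
rewrite !big_rcons/=.
have : 0 <= \prod_(d <- w) d%:R ^+ 2 :> R by apply: prodr_ge0 => *; exact: sqr_ge0.
move: (\prod_(d <- w) d%:R ^+ 2) => Q Q0.
have L0 : 0 < (last 0%N w)%:R :> R by rewrite ltr0n.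
have B0 : 0 < b%:R :> R by rewrite ltr0n.
have C0 : 0 < c%:R :> R by rewrite ltr0n.
move: (last 0%N w)%:R (b%:R) (c%:R) L0 B0 C0 h1 h2 => L B C L0 B0 C0 h1 h2.
have p0 := phi0 (size w); have p1 := phi0 (size w).+1; have p2 := phi0 (size w).+2.
move: (phi (size w)) (phi (size w).+1) (phi (size w).+2) p0 p1 p2 h1 h2 => p0 p1 p2 P0 P1 P2 h1 h2.
apply: (@le_trans _ _ (Q * p2 / 2 * ((p0 / 2) / L * (p1 / 2)))).
  by rewrite le_eqVlt; apply/orP; left; apply/eqP; field; rewrite gt_eqF.
apply: (@le_trans _ _ (Q * p2 / 2 * (B * (B * C)))).
  rewrite ler_wpM2l ?divr_ge0 ?mulr_ge0 ?(ltW P2)//.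
  rewrite ler_pM ?divr_ge0 ?(ltW P0) ?(ltW P1) ?(ltW L0)//.
  by rewrite ler_pdivrMr// [leRHS]mulrC.
by rewrite le_eqVlt; apply/orP; left; apply/eqP; field; rewrite gt_eqF.
Qed.

(** * Vanishing of the content *)

Section content_bound.
Variable s : R.
Hypothesis s0 : 0 < s.
Variable N0 : nat.
(** Number of admissible pairs of digits times the s-th power of the contraction: each pair appended
    halves the bound on the content. *)
Hypothesis N0P : forall n, (N0 <= n)%N -> 8 * phi n.+1 * (scale_step n)^-1 `^ s <= 2^-1.

(* Appending two digits b, c at a time: there are at most 8 phi(n+1) admissible
   pairs, by the lower bound on w_n b and the upper bounds on w_n b and b c. *)
Lemma cylinder_content_step m w (e : R) : (m < size w)%N -> 0 <= e ->
  (forall b c, (hausdorff_content s (cylinder m (rcons (rcons w b) c)) <= e%:E)%E) ->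
  (hausdorff_content s (cylinder m w) <= (8 * phi (size w).+1 * e)%:E)%E.
Proof.
move=> mw e0 he; have [->|/set0P ne] := eqVneq (cylinder m w) set0.
  by rewrite hausdorff_content0 lee_fin !mulr_ge0 ?(ltW (phi0 _)).
have l0 : 0 < (last 0%N w)%:R :> R.
  by rewrite ltr0n (cylinder_digits_gt0 ne)//; exact: last_mem mw.
have ext x := @cylinder_rcons m w x mw.
move: l0 ext; set l := (last 0%N w)%:R : R => l0 ext.
have p0 := phi0 (size w); have p1 := phi0 (size w).+1.
(* The first factor bounds b. Given b >= phi(n)/(2 l), the bound 2 phi(n+1)/b on c is at most the
   second one, 4 phi(n+1) l/phi(n). *)
have -> : 8 * phi (size w).+1 * e =
    2 * phi (size w) / l * (4 * phi (size w).+1 * l / phi (size w) * e).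
  by field; rewrite !gt_eqF.
apply: (@hausdorff_content_bigcup_le _ _ _ _
  (fun b => (0 < b)%N && (phi (size w) / 2 <= l * b%:R)) (fun b => cylinder m (rcons w b))).
- by rewrite divr_ge0 ?mulr_ge0 ?ltW.
- by rewrite mulr_ge0// divr_ge0 ?mulr_ge0 ?ltW.
- move=> x /ext[b [b0 bx /andP[h1 h2]]]; exists b => //=.
  by rewrite b0 h1 !andbT/= ler_pdivlMr// [leLHS]mulrC.
move=> b /andP[b0 hb].
have mwb : (m < size (rcons w b))%N by rewrite size_rcons leqW.
have B0 : 0 < b%:R :> R by rewrite ltr0n.
apply: (@le_trans _ _ (2 * phi (size w).+1 / b%:R * e)%:E).
  apply: (@hausdorff_content_bigcup_le _ _ _ _ predT
    (fun c => cylinder m (rcons (rcons w b) c))) => //.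
  - by rewrite divr_ge0 ?mulr_ge0 ?ltW.
  - move=> x /(cylinder_rcons mwb)[c [c0 cx]]; rewrite last_rcons size_rcons => /andP[_ h2].
    by exists c => //=; rewrite c0 andbT/= ler_pdivlMr// [leLHS]mulrC.
rewrite lee_fin ler_wpM2r// ler_pdivrMr// mulrAC ler_pdivlMr//.
have : phi (size w).+1 * phi (size w) <= phi (size w).+1 * (2 * (l * b%:R)).
  by rewrite ler_pM2l//; move: hb; lra.
by lra.
Qed.

(** J is the number of pairs of digits appended before each resulting cylinder is covered by
    itself. *)
Lemma cylinder_content_le m w J : (m < size w)%N -> (N0 <= size w)%N ->
  (hausdorff_content s (cylinder m w) <=
     (2^-1 ^+ J * (cylinder_scale w)^-1 `^ s)%:E)%E.
Proof.
elim: J w => [|J ih] w mw Nw.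
  have [->|/set0P ne] := eqVneq (cylinder m w) set0.
    by rewrite hausdorff_content0 lee_fin mulr_ge0 ?powR_ge0.
  rewrite expr0 mul1r; apply: hausdorff_content_le_diam; first exact: ltW.
    by rewrite invr_ge0 ltW// (cylinder_scale_gt0 mw).
  by move=> x y; exact: cylinder_dist.
have [->|/set0P ne] := eqVneq (cylinder m w) set0.
  by rewrite hausdorff_content0 lee_fin mulr_ge0 ?powR_ge0 ?exprn_ge0.
have c0 := cylinder_scale_gt0 mw ne; have k0 := scale_step_gt0 (size w).
pose e := 2^-1 ^+ J * (cylinder_scale w * scale_step (size w))^-1 `^ s.
have e0 : 0 <= e by rewrite mulr_ge0 ?powR_ge0 ?exprn_ge0.
apply: (@le_trans _ _ (8 * phi (size w).+1 * e)%:E).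
  apply: cylinder_content_step => // b c.
  have mwbc : (m < size (rcons (rcons w b) c))%N by rewrite !size_rcons !leqW.
  have Nwbc : (N0 <= size (rcons (rcons w b) c))%N by rewrite !size_rcons !leqW.
  have [->|/set0P nebc] := eqVneq (cylinder m (rcons (rcons w b) c)) set0.
    by rewrite hausdorff_content0 lee_fin.
  apply: (le_trans (ih _ mwbc Nwbc)); rewrite lee_fin ler_wpM2l ?exprn_ge0//.
  have d0 := cylinder_scale_gt0 mwbc nebc.
  apply: ge0_ler_powR; first exact: ltW.
  - by rewrite nnegrE invr_ge0 ltW.
  - by rewrite nnegrE invr_ge0 ltW// mulr_gt0.
  - rewrite lef_pV2 ?posrE//; last exact: mulr_gt0.
    exact: cylinder_scale_step mw nebc.
rewrite lee_fin /e invfM powRM ?invr_ge0 ?(ltW c0) ?(ltW k0)//.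
have := N0P Nw; set t := _ `^ s; set p := phi _ => h.
have -> : 8 * p * (2^-1 ^+ J * ((cylinder_scale w)^-1 `^ s * t)) =
  8 * p * t * (2^-1 ^+ J * (cylinder_scale w)^-1 `^ s) by ring.
by rewrite exprS -[leRHS]mulrA ler_wpM2r// mulr_ge0 ?powR_ge0 ?exprn_ge0.
Qed.

Lemma cylinder_content_eq0 m w : (m < size w)%N -> (N0 <= size w)%N ->
  hausdorff_content s (cylinder m w) = 0%E.
Proof.
move=> mw Nw; apply/eqP; rewrite eq_le hausdorff_content_ge0 andbT.
apply/lee_addgt0Pr => e e0; rewrite add0e.
set Z := (cylinder_scale w)^-1 `^ s.
have Z0 : 0 <= Z by exact: powR_ge0.
have : 2^-1 ^+ J * Z @[J --> \oo] --> (0 * Z : R).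
  apply: cvgM; last exact: cvg_cst.
  by apply: cvg_expr; rewrite ger0_norm// invf_lt1// ltr1n.
rewrite mul0r => /cvgr_le/(_ e e0)[J _ /(_ J (leqnn J))/= h].
by apply: (le_trans (cylinder_content_le J mw Nw)); rewrite lee_fin.
Qed.

Lemma level_set_cylinders :
  cf_level_set phi `<=` \bigcup_(mw : nat * seq nat)
    (if (mw.1 < size mw.2)%N && (N0 <= size mw.2)%N then cylinder mw.1 mw.2 else set0).
Proof.
move=> x Ex; have [ix x01 _] := Ex.
have := (cf_level_setP phi0 (expR_expr_ratio_cvg0 alpha_gt1) ix x01).1 Ex.
have [a0 xE] := cf_value_partial_quotients ix x01.
set a := partial_quotients x in a0 xE *; move=> cvg1.
have [m _ mP] : \forall n \near \oo, 2^-1 <= (a n)%:R * (a n.+1)%:R / phi n.+1 <= 2.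
  near=> n; apply/andP; split; near: n.
  - by apply: (cvgr_ge _ cvg1); rewrite invf_lt1// ltr1n.
  - by apply: (cvgr_le _ cvg1); rewrite ltr1n.
(* This length exceeds m and is at least [N0], as the content bound demands; pairs of an index and a
   word are countable. *)
have [w sw wE] : exists2 w, size w = (m.+1 + N0)%N &
    forall i, (i < m.+1 + N0)%N -> a i = nth 0%N w i.
  exists (mkseq a (m.+1 + N0)); first exact: size_mkseq.
  by move=> i iK; rewrite nth_mkseq.
exists (m, w) => //=; rewrite sw leq_addr leq_addl/=.
exists a; split=> //; first by rewrite sw.
move=> i /mP/=; rewrite ler_pdivlMr// ler_pdivrMr//.
by rewrite [2^-1 * _]mulrC.
Unshelve. all: by end_near. Qed.

Lemma level_set_content_eq0 : hausdorff_content s (cf_level_set phi) = 0%E.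
Proof.
apply/eqP; rewrite eq_le hausdorff_content_ge0 andbT.
apply: (le_trans (le_hausdorff_content s level_set_cylinders)).
rewrite hausdorff_content_countable// => -[m w] /=.
by case: ifP => [/andP[]|_]; [exact: cylinder_content_eq0|rewrite hausdorff_content0].
Qed.
End content_bound.

Lemma hausdorff_measure_level_set_eq0 (s : R) : 1 / (1 + alpha) < s ->
  hausdorff_measure s (cf_level_set (fun n => expR (alpha ^+ n))) = 0%E.
Proof.
move=> sa; have s0 : 0 < s by apply: lt_trans sa; rewrite divr_gt0.
apply: hausdorff_measure_eq0 => //.
have c0 : 0 < (s * (1 + alpha) - 1) * alpha.
  by rewrite mulr_gt0// subr_gt0 -ltr_pdivrMr.
(* With E = exp((s (1 + alpha) - 1) alpha^(n+1)), the quantity to be bounded by 1/2 equals 8 *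
   4^s/E, whence the constant 16 * 4^s. *)
have [N0 _ N0P] := expR_expr_dominates (16 * 4 `^ s) alpha_gt1 c0.
apply: (@level_set_content_eq0 s s0 N0) => n Nn.
have big : 16 * 4 `^ s <= expR ((s * (1 + alpha) - 1) * alpha * alpha ^+ n).
  apply: le_trans (N0P n Nn); rewrite ler_peMr ?mulr_ge0 ?powR_ge0//.
  by rewrite exprn_ege1// ler1n.
rewrite /scale_step invf_div powRM ?invr_ge0 ?mulr_ge0 ?(ltW (phi0 _))//.
have -> : (phi n.+1 * phi n.+2)^-1 `^ s = (expR (s * (1 + alpha) * alpha ^+ n.+1))^-1.
  rewrite /phi -expRD -expRN -expRM -expRN; congr expR.
  by rewrite [alpha ^+ n.+2]exprS; ring.
have -> : expR (s * (1 + alpha) * alpha ^+ n.+1) =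
    expR ((s * (1 + alpha) - 1) * alpha * alpha ^+ n) * phi n.+1.
  by rewrite /phi -expRD; congr expR; rewrite exprS; ring.
have E0 := expR_gt0 ((s * (1 + alpha) - 1) * alpha * alpha ^+ n).
move: (expR _) E0 big => E E0 big.
have p0 := phi0 n.+1.
have -> : 8 * phi n.+1 * (4 `^ s * (E * phi n.+1)^-1) = 8 * 4 `^ s / E.
  by field; rewrite !gt_eqF.
by rewrite ler_pdivrMr//; lra.
Qed.
End upper_bound.

Theorem theorem1p7 (R : realType) (alpha : R) (halpha : 1 < alpha) :
  hausdorff_dim (cf_level_set (fun n : nat => expR (alpha ^+ n)))
  = (1 / (1 + alpha))%:E.
Proof.
apply/eqP; rewrite eq_le; apply/andP; split.
  (* The measure vanishes at the exponent 1/(1 + alpha) + e for every e > 0, which bounds the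
     infimum. *)
  apply/lee_addgt0Pr => e e0; rewrite -EFinD.
  apply: ereal_inf_lbound; exists (1 / (1 + alpha) + e) => //; split.
    by rewrite addr_ge0 ?(ltW e0)// divr_ge0 ?addr_ge0// (le_trans ler01)// ltW.
  by apply: hausdorff_measure_level_set_eq0 => //; rewrite ltrDl.
apply: le_ereal_inf_tmp => _ [s [s0 sE] <-]; rewrite lee_fin leNgt.
by apply/negP => /(hausdorff_measure_level_set_neq0 halpha s0); rewrite sE eqxx.
Qed.
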